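(* Let $\mathbb{F}$ be either $\mathbb{R}$ or $\mathbb{C}$, and let $X_1$, $X_2$ be first countable completely regular topological spaces. Then for every isomorphism of $\mathbb{F}$-algebras $\Phi:C(X_1;\mathbb{F})\to C(X_2;\mathbb{F})$ there is a homeomorphism $\varphi:X_2\to X_1$ such that $\Phi$ is the pullback by $\varphi$, i.e. $\Phi(f)=f\circ\varphi$ for all $f\in C(X_1;\mathbb{F})$.
   Context: For a topological space $X$, $C(X;\mathbb{F})$ denotes the associative $\mathbb{F}$-algebra of all $\mathbb{F}$-valued continuous functions on $X$ (not necessarily bounded). Completely regular spaces are understood to be Hausdorff (i.e. Tychonoff spaces). *)

(* Defs.v *)
From HB Require Import structures.
From mathcomp Require Import all_boot all_order all_algebra.
From mathcomp Require Import complex.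
From mathcomp Require Import all_classical all_reals all_analysis.
Import Order.TTheory GRing.Theory Num.Theory.
Import numFieldTopology.Exports numFieldNormedType.Exports.

Set Implicit Arguments.
Unset Strict Implicit.
Unset Printing Implicit Defensive.

Local Open Scope classical_set_scope.
Local Open Scope ring_scope.

(* The pointwise algebra structure on the type [continuousType X F] of all
   continuous functions X -> F.  The space X may be empty, in which case this
   is the zero ring, so the structure is that of a (possibly zero) commutative
   ring that is an F-module, and not MathComp's [algType], which excludes the
   zero ring. *)
Section continuous_algebra.
Context {X : topologicalType} {F : numFieldType}.
Implicit Types f g h : continuousType X F.

Fact cts_zero_subproof : continuous (fun _ : X => 0 : F).
Proof. by move=> x; exact: cvg_cst. Qed.
Definition cts_zero : continuousType X F := mkcts cts_zero_subproof.

Fact cts_one_subproof : continuous (fun _ : X => 1 : F).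
Proof. by move=> x; exact: cvg_cst. Qed.
Definition cts_one : continuousType X F := mkcts cts_one_subproof.

Fact cts_add_subproof f g : continuous (fun x => f x + g x).
Proof. by move=> x; apply: cvgD; exact: cts_fun. Qed.
Definition cts_add f g : continuousType X F := mkcts (@cts_add_subproof f g).

Fact cts_opp_subproof f : continuous (fun x => - f x).
Proof. by move=> x; apply: cvgN; exact: cts_fun. Qed.
Definition cts_opp f : continuousType X F := mkcts (@cts_opp_subproof f).

Fact cts_mul_subproof f g : continuous (fun x => f x * g x).
Proof. by move=> x; apply: cvgM; exact: cts_fun. Qed.
Definition cts_mul f g : continuousType X F := mkcts (@cts_mul_subproof f g).

Fact cts_scale_subproof (a : F) f : continuous (fun x => a * f x).
Proof. by move=> x; apply: cvgM; [exact: cvg_cst | exact: cts_fun]. Qed.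
Definition cts_scale (a : F) f : continuousType X F :=
  mkcts (@cts_scale_subproof a f).

Fact cts_addA : associative cts_add.
Proof. by move=> f g h; apply/continuousEP => x; exact: addrA. Qed.
Fact cts_addC : commutative cts_add.
Proof. by move=> f g; apply/continuousEP => x; exact: addrC. Qed.
Fact cts_add0 : left_id cts_zero cts_add.
Proof. by move=> f; apply/continuousEP => x; exact: add0r. Qed.
Fact cts_addN : left_inverse cts_zero cts_opp cts_add.
Proof. by move=> f; apply/continuousEP => x; exact: addNr. Qed.
HB.instance Definition _ := GRing.isZmodule.Build (continuousType X F)
  cts_addA cts_addC cts_add0 cts_addN.

Fact cts_mulA : associative cts_mul.
Proof. by move=> f g h; apply/continuousEP => x; exact: mulrA. Qed.
Fact cts_mulC : commutative cts_mul.
Proof. by move=> f g; apply/continuousEP => x; exact: mulrC. Qed.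
Fact cts_mul1 : left_id cts_one cts_mul.
Proof. by move=> f; apply/continuousEP => x; exact: mul1r. Qed.
Fact cts_mulDl : left_distributive cts_mul +%R.
Proof. by move=> f g h; apply/continuousEP => x; exact: mulrDl. Qed.
HB.instance Definition _ := GRing.Zmodule_isComPzRing.Build
  (continuousType X F) cts_mulA cts_mulC cts_mul1 cts_mulDl.

Fact cts_scaleA (a b : F) f : cts_scale a (cts_scale b f) = cts_scale (a * b) f.
Proof. by apply/continuousEP => x; exact: mulrA. Qed.
Fact cts_scale1 : left_id 1 cts_scale.
Proof. by move=> f; apply/continuousEP => x; exact: mul1r. Qed.
Fact cts_scaleDr : right_distributive cts_scale +%R.
Proof. by move=> a f g; apply/continuousEP => x; exact: mulrDr. Qed.
Fact cts_scaleDl f : {morph cts_scale^~ f : a b / a + b}.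
Proof. by move=> a b; apply/continuousEP => x; exact: mulrDl. Qed.
HB.instance Definition _ := GRing.Zmodule_isLmodule.Build F
  (continuousType X F) cts_scaleA cts_scale1 cts_scaleDr cts_scaleDl.

Lemma cts_ringE :
  [/\ forall x, (0 : continuousType X F) x = 0,
      forall x, (1 : continuousType X F) x = 1,
      forall f g x, (f + g) x = f x + g x,
      forall f g x, (f * g) x = f x * g x &
      forall (a : F) f x, (a *: f) x = a * f x].
Proof. by []. Qed.

Lemma cts_scaleAl (a : F) f g : a *: (f * g) = (a *: f) * g.
Proof. by apply/continuousEP => x; exact: mulrA. Qed.

End continuous_algebra.

(* Stated with separate clauses since MathComp's {lrmorphism _ -> _} requires
   nonzero rings; preservation of 1 is automatic for a multiplicative
   bijection. *)
Definition algebra_isomorphism (F : numFieldType) (X Y : topologicalType)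
    (Phi : continuousType X F -> continuousType Y F) : Prop :=
  [/\ linear Phi, monoid_morphism Phi & bijective Phi].

(* [completely_regular_space] separates points from closed sets but does not
   include the Hausdorff axiom. *)
Definition tychonoff_space (X : topologicalType) : Prop :=
  hausdorff_space X /\ completely_regular_space X.

(* [completely_regular_space] is phrased with uniformities; this is its
   description by real-valued functions. *)
Lemma completely_regular_spaceP (R : realType) (X : topologicalType) :
  completely_regular_space X <->
  forall (a : X) (B : set X), closed B -> ~ B a ->
    exists f : X -> R, [/\ continuous f, range f `<=` `[0, 1],
      f a = 0 & forall b, B b -> f b = 1].
Proof.
split=> H a B cB nBa.
  have /(@uniform_separatorP X R)[f [cf f01 f0 f1]] := H a B cB nBa.
  exists f; split=> //; first by apply: f0; exists a.
  by move=> b Bb; apply: f1; exists b.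
have [f [cf f01 f0 f1]] := H a B cB nBa.
apply/(@uniform_separatorP X R); exists f; split=> //.
  by move=> _ [_ -> <-].
by move=> _ [b Bb <-]; exact: f1.
Qed.

Definition first_countable (X : topologicalType) : Prop :=
  forall x : X, exists B : set (set X),
    [/\ countable B, B `<=` nbhs x &
        forall U, nbhs x U -> exists2 V, B V & V `<=` U].

Definition homeomorphism (X Y : topologicalType) (phi : X -> Y) : Prop :=
  continuous phi /\
  exists psi : Y -> X, [/\ cancel phi psi, cancel psi phi & continuous psi].

(* Main.v *)
Require Import Defs.
From mathcomp Require Import all_boot all_order all_algebra.
From mathcomp Require Import complex.
From mathcomp Require Import all_classical all_reals all_analysis.
Import Order.TTheory GRing.Theory Num.Theory.
Import numFieldTopology.Exports numFieldNormedType.Exports.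

Set Implicit Arguments.
Unset Strict Implicit.
Unset Printing Implicit Defensive.

Local Open Scope classical_set_scope.
Local Open Scope ring_scope.

(** A ring homomorphism maps units to units, and a continuous function is a
    unit as soon as it has no zero.  Hence if [Phi f] vanishes somewhere, so
    does [f] ([vanishing_image_vanishes]).  This is the only way in which
    points are extracted from algebra.

    In a first countable Tychonoff space every point [a] is the whole zero set
    of some continuous function [f] ([singleton_zero_set]).  By the remark
    above, applied to the inverse of [Phi], the function [Phi f] has a zero
    [b].  Then [g |-> Phi g b] is evaluation at [a], for every [g] and not
    only for [f] ([evaluation_of_isolating_zero]): with [c := Phi g b], the
    function [h := |f|^2 + |g - c|^2] belongs to the algebra, because
    [|z|^2 = z * conj z] and [conj] is continuous, and [Phi h] vanishes at
    [b].  So [h] has a zero, at which both squares vanish; it is a zero of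
    [f], hence it is [a], and [g a = c].

    Choosing such a [b] for each [a] gives a map from [X1] to [X2]; the same
    argument for the inverse of [Phi] gives a map from [X2] to [X1].  These
    maps induce [Phi] and its inverse by pullback.  As continuous functions
    separate points they are inverse to each other, and as continuous
    functions separate points from closed sets they are continuous.

    First countability cannot be dropped from this argument: in general an
    algebra of continuous functions has homomorphisms to the scalars that are
    not evaluations at points, and it is the isolating function [f] that tells
    the evaluations apart from the others. *)

(** The weights [1 / n.+1] make all but finitely many terms uniformly small, so
    the family is equicontinuous: near [x] all its members move by at most [e]
    together, and therefore so does their supremum. *)
Lemma continuous_weighted_sup (R : realType) (X : topologicalType)
    (f : nat -> X -> R) :
  (forall n, continuous (f n)) -> (forall n x, 0 <= f n x <= 1) ->
  continuous (fun x => sup (range (fun n => f n x / n.+1%:R))).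
Proof.
move=> cf f01 x; set u := fun n y => f n y / n.+1%:R.
have u0 n y : 0 <= u n y by rewrite divr_ge0 //; case/andP: (f01 n y).
have ule n y : u n y <= n.+1%:R^-1.
  by rewrite ler_piMl ?invr_ge0 //; case/andP: (f01 n y).
have uub y : has_ubound (range (u^~ y)).
  exists 1 => _ [n _ <-]; apply: le_trans (ule n y) _.
  by rewrite invf_le1 ?ler1n ?ltr0n.
have supD y z e : (forall n, `|u n y - u n z| <= e) ->
    sup (range (u^~ y)) <= e + sup (range (u^~ z)).
  move=> H; apply: ge_sup; first by exists (u 0%N y), 0%N.
  move=> _ [n _ <-]; apply: (@le_trans _ _ (e + u n z)).
    by rewrite -lerBlDr (le_trans (ler_norm _)).
  by rewrite lerD2l; apply: ub_le_sup => //; exists n.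
apply/cvgrPdist_le => e e0.
have [N _ HN] := @near_infty_natSinv_lt R (PosNum e0).
have small n y : (N <= n)%N -> u n y <= e.
  by move=> Nn; apply: le_trans (ule n y) _; exact/ltW/HN.
have cu n : {for x, continuous (u n)}.
  by apply: cvgM; [exact: cf | exact: cvg_cst].
have : \forall y \near x, forall i : 'I_N, `|u i x - u i y| <= e.
  apply: filter_forall => i.
  by move/cvgrPdist_le: (cu i) => /(_ e e0).
apply: filterS => y Hy.
have H n : `|u n x - u n y| <= e.
  have [nN|Nn] := ltnP n N; first exact: (Hy (Ordinal nN)).
  rewrite ler_norml; apply/andP; split.
    by rewrite lerBrDl (le_trans _ (u0 n x)) // subr_le0 small.
  by rewrite lerBlDr (le_trans (small n x Nn)) // lerDl.
rewrite ler_distl; apply/andP; split.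
  by rewrite lerBlDr addrC; apply: supD => n; rewrite distrC.
by rewrite addrC; exact: supD.
Qed.

(** Take [f n] equal to 0 at [a] and to 1 off the [n]-th member of a countable
    neighbourhood basis of [a].  A common zero of the [f n] lies in every
    neighbourhood of [a], so it is [a] by the Hausdorff axiom; the weighted
    supremum vanishes exactly at the common zeros. *)
Lemma singleton_zero_set (R : realType) (X : topologicalType) :
  first_countable X -> tychonoff_space X ->
  forall a : X, exists2 u : X -> R, continuous u & forall x, u x = 0 <-> x = a.
Proof.
move=> fc [hX crX] a; have [B [cB Bn Bb]] := fc a.
have [|/unsquash s] := pfcard_geP cB.
  by have [V BV _] := Bb setT filterT => B0; rewrite B0 in BV.
have sB n : B (s n) by exact: funS.
have /choice[f Hf] n : exists f : X -> R, [/\ continuous f,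
    range f `<=` `[0, 1], f a = 0 & forall x, ~ interior (s n) x -> f x = 1].
  have := completely_regular_spaceP R X; case=> /(_ crX) H _.
  apply: (H a (~` interior (s n))).
    by apply: open_closedC; exact: open_interior.
  by apply; exact: Bn.
have f01 n x : 0 <= f n x <= 1.
  have [_ r01 _ _] := Hf n.
  by have := r01 (f n x); rewrite /= in_itv /=; apply; exists x.
exists (fun x => sup (range (fun n => f n x / n.+1%:R))).
  by apply: continuous_weighted_sup => // n; case: (Hf n).
move=> x; split=> [ux0|->]; last first.
  have -> : range (fun n => f n a / n.+1%:R) = [set 0]; last exact: sup1.
  apply/seteqP; split=> [_ [n _ <-]|_ ->] /=.
    by case: (Hf n) => _ _ -> _; rewrite mul0r.
  by exists 0%N => //; case: (Hf 0%N) => _ _ -> _; rewrite mul0r.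
apply/esym/hX => U W /= nU nW.
have [V BV VU] := Bb _ nU; have [n _ sn] := 'surj_s BV.
exists x; split; last exact: nbhs_singleton.
apply/VU; rewrite -sn; apply: interior_subset; apply: contrapT => nx.
have fx1 : f n x = 1 by case: (Hf n) => _ _ _; apply.
have : n.+1%:R^-1 <= sup (range (fun n => f n x / n.+1%:R)) :> R.
  apply: ub_le_sup; last by exists n => //; rewrite fx1 mul1r.
  exists 1 => _ [m _ <-]; rewrite ler_pdivrMr ?ltr0n// mul1r.
  by have /andP[_ /le_trans] := f01 m x; apply; rewrite ler1n.
by rewrite ux0 leNgt invr_gt0 ltr0n.
Qed.

Lemma isometry_continuous (F : numFieldType) (g : F -> F) :
  (forall z w, `|g z - g w| = `|z - w|) -> continuous g.
Proof.
move=> gi z.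
have [_] := @cvgrPdist_lt _ _ _ _ (nbhs_filter z) g (g z).
apply=> e e0; apply: filterS (nbhsx_ballx z e e0) => y /=.
by rewrite gi.
Qed.

(** All that the argument uses about the scalars: a copy of the reals, which
    carries separating functions over to [F], and a continuous conjugation,
    which makes [|f|^2] an element of the ideal generated by [f]. *)
Lemma real_or_complex_maps (R : realType) (F : numFieldType)
    (hF : F = R :> numFieldType \/ F = R[i] :> numFieldType) :
  exists (iota : R -> F) (conj : F -> F),
    [/\ continuous iota, iota 1 = 1, forall r, iota r = 0 <-> r = 0,
        continuous conj & forall z, z * conj z = `|z| ^+ 2].
Proof.
case: hF => ->.
  exists idfun, idfun; split=> //; try by move=> ?; exact: cvg_id.
  by move=> z; rewrite real_normK ?num_real.
exists (fun r => r%:C%C), (fun z => z^*); split=> //.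
- move=> x; apply/cvgrPdist_le => e e0.
  (* A positive element of [R[i]] is real, so the estimate is one in [R]. *)
  have [e1 e1E] : exists e1 : R, e = e1%:C%C.
    exists (complex.Re e); apply/esym/RRe_real; exact: gtr0_real.
  move: e0; rewrite e1E ltcR => e0.
  have /cvgrPdist_le/(_ e1 e0) : y @[y --> x] --> x by exact: cvg_id.
  apply: filterS => y; rewrite -rmorphB /= => H.
  by rewrite normc_def /= expr0n addr0 sqrtr_sqr lecR.
- by move=> r; split=> [[]|->].
- by apply: isometry_continuous => z w; rewrite -rmorphB norm_conjC.
- by move=> z; rewrite normCK.
Qed.

Section pointwise.
Context {X : topologicalType} {F : numFieldType}.
Implicit Types f g : continuousType X F.

Lemma cts1E x : (1 : continuousType X F) x = 1. Proof. by []. Qed.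
Lemma ctsDE f g x : (f + g) x = f x + g x. Proof. by []. Qed.
Lemma ctsME f g x : (f * g) x = f x * g x. Proof. by []. Qed.
Lemma ctsZE (a : F) f x : (a *: f) x = a * f x. Proof. by []. Qed.

End pointwise.

Lemma vanishing_image_vanishes (F : numFieldType) (X Y : topologicalType)
    (Phi : continuousType X F -> continuousType Y F) :
  monoid_morphism Phi ->
  forall (f : continuousType X F) y, Phi f y = 0 -> exists x, f x = 0.
Proof.
move=> [Phi1 PhiM] f y fy0; apply: contrapT => nf.
have f0 x : f x != 0 by apply/eqP => fx0; apply: nf; exists x.
have cV : continuous (fun x => (f x)^-1).
  by move=> x; apply: cvgV => //; exact: cts_fun.
pose g : continuousType X F := mkcts cV.
have fg1 : f * g = 1 by apply/continuousEP => x; exact: divff.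
have : Phi (f * g) y = 0.
  by rewrite PhiM ctsME fy0 mul0r.
by move/eqP; rewrite fg1 Phi1 cts1E oner_eq0.
Qed.

(** The ideal of all [h] with [Phi h y = 0] contains [|f|^2 + |g - c|^2] for
    [c := Phi g y].  No member of it is a unit, so this sum of squares has a
    zero, which can only be [a]. *)
Lemma evaluation_of_isolating_zero (F : numFieldType) (X Y : topologicalType)
    (conj : F -> F) (Phi : continuousType X F -> continuousType Y F) :
  continuous conj -> (forall z, z * conj z = `|z| ^+ 2) ->
  linear Phi -> monoid_morphism Phi ->
  forall (f : continuousType X F) a y,
  (forall x, f x = 0 -> x = a) -> Phi f y = 0 ->
  forall g, Phi g y = g a.
Proof.
move=> cc conjE linPhi mPhi f a y fa fy0 g; have [Phi1 PhiM] := mPhi.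
have cconj (h : continuousType X F) : continuous (fun x => conj (h x)).
  by move=> x; apply: continuous_comp; [exact: cts_fun | exact: cc].
pose sq (h : continuousType X F) : continuousType X F := h * mkcts (cconj h).
pose c := Phi g y; pose k := (- c) *: (1 : continuousType X F) + g.
have sqE h x : sq h x = `|h x| ^+ 2 by rewrite -conjE.
have Phisq h : Phi h y = 0 -> Phi (sq h) y = 0.
  by move=> h0; rewrite PhiM ctsME h0 mul0r.
have ky0 : Phi k y = 0.
  by rewrite linPhi Phi1 ctsDE ctsZE cts1E mulr1 addNr.
(* The factor 1 is there to match the shape [a *: u + v] of linearity. *)
have : Phi (1 *: sq f + sq k) y = 0.
  by rewrite linPhi scale1r ctsDE !Phisq // addr0.
case/(vanishing_image_vanishes mPhi) => x.
rewrite scale1r ctsDE !sqE => /eqP.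
rewrite paddr_eq0 ?exprn_ge0 // !sqrf_eq0 !normr_eq0 => /andP[/eqP/fa -> /eqP].
rewrite ctsDE ctsZE cts1E mulr1 => /eqP.
by rewrite addrC subr_eq0 => /eqP.
Qed.

Lemma evaluation_transport (R : realType) (F : numFieldType)
    (hF : F = R :> numFieldType \/ F = R[i] :> numFieldType)
    (X Y : topologicalType) (fcX : first_countable X) (crX : tychonoff_space X)
    (Phi : continuousType X F -> continuousType Y F)
    (Psi : continuousType Y F -> continuousType X F) :
  linear Phi -> monoid_morphism Phi -> monoid_morphism Psi -> cancel Phi Psi ->
  forall a, exists b, forall g, Phi g b = g a.
Proof.
move=> linPhi mPhi mPsi PhiK a.
have [iota [conj [ci _ i0 cc conjE]]] := real_or_complex_maps hF.
have [u cu u0] := @singleton_zero_set R X fcX crX a.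
have cf : continuous (iota \o u).
  by move=> x; apply: continuous_comp; [exact: cu | exact: ci].
pose f : continuousType X F := mkcts cf.
have [|b fb0] := vanishing_image_vanishes mPsi (f := Phi f) (y := a).
  by rewrite PhiK; apply/i0/u0.
exists b; apply: (evaluation_of_isolating_zero cc conjE linPhi mPhi) fb0.
by move=> x /i0/u0.
Qed.

Lemma separating_function (R : realType) (F : numFieldType)
    (hF : F = R :> numFieldType \/ F = R[i] :> numFieldType)
    (X : topologicalType) (crX : completely_regular_space X) a (B : set X) :
  closed B -> ~ B a ->
  exists f : continuousType X F, f a = 0 /\ forall b, B b -> f b = 1.
Proof.
move=> cB nBa; have [iota [_ [ci i1 i0 _ _]]] := real_or_complex_maps hF.
have := completely_regular_spaceP R X; case=> /(_ crX a B cB nBa) + _.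
move=> [u [cu _ ua ub]].
have cf : continuous (iota \o u).
  by move=> x; apply: continuous_comp; [exact: cu | exact: ci].
exists (mkcts cf); split; first exact/i0.
by move=> b Bb; rewrite -i1 -(ub b Bb).
Qed.

Lemma eq_of_continuous_functions (R : realType) (F : numFieldType)
    (hF : F = R :> numFieldType \/ F = R[i] :> numFieldType)
    (X : topologicalType) (crX : tychonoff_space X) (a b : X) :
  (forall f : continuousType X F, f a = f b) -> a = b.
Proof.
have [hX cX] := crX => H; apply: contrapT => nab.
have cb : closed [set b].
  exact: accessible_closed_set1 (hausdorff_accessible hX) _.
have [f [fa fb]] := separating_function hF cX cb nab.
by have /eqP := H f; rewrite fa fb // eq_sym oner_eq0.
Qed.

(** A completely regular space carries the initial topology of its continuous
    functions: a function with value 0 at [phi y] and 1 off an open set [V]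
    shows that [phi] maps a neighbourhood of [y] into [V]. *)
Lemma continuous_of_pullback (R : realType) (F : numFieldType)
    (hF : F = R :> numFieldType \/ F = R[i] :> numFieldType)
    (X Y : topologicalType) (crX : completely_regular_space X) (phi : Y -> X) :
  (forall f : continuousType X F, continuous (f \o phi)) -> continuous phi.
Proof.
move=> H y U; rewrite nbhsE => -[V [oV Vy] VU].
have nVy : ~ (~` V) (phi y) by apply.
have [f [f0 f1]] := separating_function hF crX (open_closedC oV) nVy.
have n1 : nbhs (f (phi y)) (~` [set (1 : F)]).
  apply: open_nbhs_nbhs; split; last first.
    by rewrite f0 /=; apply/eqP; rewrite eq_sym oner_neq0.
  apply: closed_openC; apply: accessible_closed_set1.
  exact/hausdorff_accessible/(@norm_hausdorff _ F^o).
have nH : nbhs y ((f \o phi) @^-1` ~` [set (1 : F)]) by exact: H n1.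
apply: filterS nH => z /= fz1; apply: VU; apply: contrapT => nV.
by apply: fz1; exact: f1.
Qed.

Theorem corollary1 (R : realType) (F : numFieldType)
    (hF : F = R :> numFieldType \/ F = R[i] :> numFieldType)
    (X1 X2 : topologicalType)
    (fc1 : first_countable X1) (cr1 : tychonoff_space X1)
    (fc2 : first_countable X2) (cr2 : tychonoff_space X2)
    (Phi : continuousType X1 F -> continuousType X2 F)
    (isoPhi : algebra_isomorphism Phi) :
  exists phi : X2 -> X1, homeomorphism phi /\
    forall f : continuousType X1 F, Phi f = f \o phi :> (X2 -> F).
Proof.
have [linPhi mPhi [Psi PhiK PsiK]] := isoPhi.
have linPsi : linear Psi.
  by move=> a u v; apply: (can_inj PhiK); rewrite linPhi !PsiK.
have mPsi : monoid_morphism Psi.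
  case: mPhi => Phi1 PhiM; split; first by rewrite -Phi1 PhiK.
  by move=> u v; apply: (can_inj PhiK); rewrite PhiM !PsiK.
have /choice[psi psiE] := evaluation_transport hF fc1 cr1 linPhi mPhi mPsi PhiK.
have /choice[phi phiE] := evaluation_transport hF fc2 cr2 linPsi mPsi mPhi PsiK.
have PhiE f y : Phi f y = f (phi y) by rewrite -phiE PhiK.
have PsiE g x : Psi g x = g (psi x) by rewrite -psiE PsiK.
exists phi; split; last by move=> f; apply/funext => y; exact: PhiE.
split.
  apply: (continuous_of_pullback hF cr1.2) => f.
  rewrite (_ : f \o phi = Phi f); first exact: cts_fun.
  by apply/funext => y; rewrite PhiE.
exists psi; split.
- move=> y; apply: (eq_of_continuous_functions hF cr2) => g.
  by rewrite -PsiE phiE.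
- move=> x; apply: (eq_of_continuous_functions hF cr1) => f.
  by rewrite -PhiE psiE.
- apply: (continuous_of_pullback hF cr2.2) => g.
  rewrite (_ : g \o psi = Psi g); first exact: cts_fun.
  by apply/funext => x; rewrite PsiE.
Qed.
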